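(* Let $$f(x_1,\dots,x_n,y_1,\dots,y_n)=\sum_{i=1}^n x_iy_i$$ be the dot-product, as a polynomial over $\mathbb{Z}_m$ in $2n$ variables, where $m$ is a fixed integer. (i) Let $m=p_1p_2$, where $p_1\ne p_2$ are primes. Then a degree-2 1-a-strong representation of $f$ modulo $m$ can be computed with $$\exp\left(O(\sqrt{\log n\,\log\log n})\right)$$ multiplications. (ii) Let $m=p_1^{e_1}p_2^{e_2}\cdots p_r^{e_r}$ be the prime decomposition of $m$. Then a degree-2 1-a-strong representation of $f$ modulo $m$ can be computed using $$\exp\left(O\left(\sqrt[r]{\log n\,(\log\log n)^{r-1}}\right)\right)$$ multiplications. (iii) Moreover, the representations of (i) and (ii) can be computed on bilinear $\Sigma\Pi\Sigma$ circuits of size $\exp\left(O(\sqrt{\log n\,\log\log n})\right)$ and $\exp\left(O\left(\sqrt[r]{\log n\,(\log\log n)^{r-1}}\right)\right)$, respectively. Here the asymptotics are as $n\to\infty$, and the implied constants may depend on $m$ but not on $n$.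
   Context: $\mathbb{Z}_m$ denotes the ring of integers modulo $m$. Representations of polynomials. Let $m=p_1^{e_1}p_2^{e_2}\cdots p_\ell^{e_\ell}$ be the prime factorization of $m$, with distinct primes $p_j$. Let $f=\sum_{I\subset\{1,\dots,N\}}a_Iz_I$ and $g=\sum_{I\subset\{1,\dots,N\}}b_Iz_I$ be (formal, multilinear) polynomials in $N$ variables $z_1,\dots,z_N$ over $\mathbb{Z}_m$, where $z_I=\prod_{i\in I}z_i$. Then $g$ is an alternative representation of $f$ modulo $m$ if for every $I$ there is $j\in\{1,\dots,\ell\}$ with $a_I\equiv b_I\pmod{p_j^{e_j}}$. It is a 1-a-strong representation of $f$ modulo $m$ if it is an alternative representation and, furthermore, whenever $a_I\not\equiv b_I\pmod{p_i^{e_i}}$ for some $i$, then $a_I\equiv 0\pmod m$. A degree-2 representation is one that is a polynomial of degree 2. Computation model. Computations are arithmetic over $\mathbb{Z}_m$ on formal polynomials, using additions, multiplications by constants from $\mathbb{Z}_m$, and multiplications of two computed polynomials; the number of multiplications counts only the last kind. A bilinear $\Sigma\Pi\Sigma$ circuit over $\mathbb{Z}_m$ in the variables $x=(x_1,\dots,x_n)$, $y=(y_1,\dots,y_n)$ is a depth-3 arithmetic circuit computing a polynomial in the form $\sum_{t=1}^{L}L_t(x)\,M_t(y)$, where each $L_t$ is a homogeneous linear form in $x_1,\dots,x_n$ and each $M_t$ is a homogeneous linear form in $y_1,\dots,y_n$, with coefficients in $\mathbb{Z}_m$. The size of the circuit is its number of gates (summation gates may have arbitrary fan-in and arbitrary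 coefficients from $\mathbb{Z}_m$). *)

(* Defs.v *)
From Stdlib Require Import Reals.
From mathcomp Require Import all_boot all_algebra.
From mathcomp Require Import mpoly.

Set Implicit Arguments.
Unset Strict Implicit.
Unset Printing Implicit Defensive.

Import GRing.Theory.
Local Open Scope ring_scope.

Definition multilinear (N : nat) (A : comNzRingType) (f : {mpoly A[N]}) : Prop :=
  forall mon : 'X_{1..N}, mon \in msupp f -> forall i : 'I_N, (mon i <= 1)%N.

Definition coef_set (N : nat) (A : comNzRingType) (f : {mpoly A[N]})
  (I : {set 'I_N}) : A := f@_(mesym1 I).

(* An element of 'Z_m is read as its representative in {0, ..., m - 1}, so
   congruences modulo a divisor of m are congruences of natural numbers. The
   prime powers in the factorization of m are the p ^ logn p m, p \in primes m.
   These definitions are meant for 1 < m, since 'Z_0 and 'Z_1 are 'Z_2. *)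
Definition coef_congr (m N : nat) (f g : {mpoly 'Z_m[N]}) (I : {set 'I_N})
  (p : nat) : Prop :=
  (coef_set f I : nat) = (coef_set g I : nat) %[mod p ^ logn p m].

Definition alternative_repr (m N : nat) (f g : {mpoly 'Z_m[N]}) : Prop :=
  [/\ multilinear f, multilinear g &
      forall I : {set 'I_N}, exists2 p : nat, p \in primes m & coef_congr f g I p].

Definition one_a_strong_repr (m N : nat) (f g : {mpoly 'Z_m[N]}) : Prop :=
  alternative_repr f g /\
  forall I : {set 'I_N},
    (exists2 p : nat, p \in primes m & ~ coef_congr f g I p) ->
    coef_set f I = 0.

(* msize is the total degree plus one. *)
Definition degree2_one_a_strong_repr (m N : nat) (f g : {mpoly 'Z_m[N]}) : Prop :=
  one_a_strong_repr f g /\ msize g = 3%N.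

(* The 2n variables are indexed by 'I_(n + n): first the x_i, then the y_i. *)
Definition xvar (A : comNzRingType) (n : nat) (i : 'I_n) : {mpoly A[n + n]} :=
  'X_(lshift n i).

Definition yvar (A : comNzRingType) (n : nat) (i : 'I_n) : {mpoly A[n + n]} :=
  'X_(rshift n i).

Definition dot_product (A : comNzRingType) (n : nat) : {mpoly A[n + n]} :=
  \sum_(i < n) xvar A i * yvar A i.

(* [slp s k]: s lists the polynomials produced by a straight-line computation
   in which k multiplications of two computed polynomials occur. *)
Inductive slp (A : comNzRingType) (N : nat) : seq {mpoly A[N]} -> nat -> Prop :=
| slp_nil : slp [::] 0
| slp_var s k (i : 'I_N) : slp s k -> slp ('X_i :: s) k
| slp_add s k f g : slp s k -> f \in s -> g \in s -> slp (f + g :: s) k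
| slp_scale s k (c : A) f : slp s k -> f \in s -> slp (c *: f :: s) k
| slp_mul s k f g : slp s k -> f \in s -> g \in s -> slp (f * g :: s) k.+1.

Definition computable_with_mults (A : comNzRingType) (N : nat)
  (f : {mpoly A[N]}) (k : nat) : Prop :=
  exists2 s : seq {mpoly A[N]}, slp s k & f \in s.

(* The bottom layer consists of [nx] summation gates reading the x_i and [ny]
   summation gates reading the y_i; a bottom gate may feed several product
   gates. Each row of [xcoef] and [ycoef] holds the coefficients of one gate. *)
Record bilinear_SPS (A : comNzRingType) (n : nat) := BilinearSPS {
  nx : nat;
  ny : nat;
  nprod : nat;
  xcoef : 'M[A]_(nx, n);
  ycoef : 'M[A]_(ny, n);
  prod_gate : 'I_nprod -> 'I_nx * 'I_ny;
  top_coef : 'I_nprod -> A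
}.

Definition xform (A : comNzRingType) (n : nat) (c : bilinear_SPS A n)
  (k : 'I_(nx c)) : {mpoly A[n + n]} := \sum_(i < n) xcoef c k i *: xvar A i.

Definition yform (A : comNzRingType) (n : nat) (c : bilinear_SPS A n)
  (k : 'I_(ny c)) : {mpoly A[n + n]} := \sum_(i < n) ycoef c k i *: yvar A i.

Definition circuit_value (A : comNzRingType) (n : nat) (c : bilinear_SPS A n) :
  {mpoly A[n + n]} :=
  \sum_(t < nprod c)
    top_coef t *: (xform (prod_gate t).1 * yform (prod_gate t).2).

(* Summation and product gates are counted, input variables are not: counting
   them would make every size bound at least linear in n. *)
Definition circuit_size (A : comNzRingType) (n : nat) (c : bilinear_SPS A n) : nat :=
  (nx c + ny c + nprod c + 1)%N.

Definition computable_with_size (A : comNzRingType) (n : nat)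
  (f : {mpoly A[n + n]}) (k : nat) : Prop :=
  exists2 c : bilinear_SPS A n, circuit_size c = k & circuit_value c = f.

(* [expO h cost]: as n grows, exp (O (h n)) units of the resource suffice, where
   [cost n k] says that k units suffice at n. *)
Definition expO (h : nat -> R) (cost : nat -> nat -> Prop) : Prop :=
  exists (C : R) (n0 : nat), forall n : nat, (n0 <= n)%N ->
    exists2 k : nat, cost n k & Rle (INR k) (exp (Rmult C (Rabs (h n)))).

Local Open Scope R_scope.

Definition rate_two (n : nat) : R := sqrt (ln (INR n) * ln (ln (INR n))).

(* Rpower u (1 / r) is the r-th root of u for u > 0; here u > 0 for n >= 3. *)
Definition rate (r n : nat) : R :=
  Rpower (ln (INR n) * ln (ln (INR n)) ^ r.-1) (1 / INR r).

(* Main.v *)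
Require Import Defs.
From Stdlib Require Import Reals Lra IndefiniteDescription.
From mathcomp Require Import all_boot all_algebra cyclic.
From mathcomp Require Import mpoly zify.

(* A degree-2 1-a-strong representation of the dot product is a bilinear form
   with matrix B having ones on the diagonal and, off the diagonal, entries
   divisible by some prime power of m; a factorization of B through R coordinates
   computes the form with R products of two linear forms. Give each index i a word
   c(i) of length K over h letters, with h^K >= n, and put B(i,j) = P(w) for w the
   Hamming distance of c(i) and c(j). As in the Barrington-Beigel-Rudich
   representation of OR modulo m, P(0) = 1, while each w in 1..K kills P modulo a
   prime power of m: if the product of the p^(a p) exceeds K, some p^(a p) does
   not divide w, and then p does not divide C(w, p^j) for j = v_p(w) < a p. The
   matrix C(w, q) has rank at most (h K)^q, and ranks add and multiply along with
   entries, so B has rank (h K)^O(K^(1/r)). Letting h be about log n and K about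
   log n / log log n gives the bound. *)

Set Implicit Arguments.
Unset Strict Implicit.
Unset Printing Implicit Defensive.

(** * Matrices over the natural numbers that factor through few coordinates *)

(** Entries are natural numbers, so that one factorization can be tested for divisibility by each
    prime power and also cast into any ring. The inner index is an arbitrary [finType], so sums and
    entrywise products of matrices use [J + J'] and [J * J'] directly. *)
Definition rank_le (T : Type) (B : T -> T -> nat) (R : nat) : Prop :=
  exists (J : finType) (U : T -> J -> nat) (V : J -> T -> nat),
    #|J| <= R /\ forall u v, B u v = \sum_k U u k * V k v.

Lemma rank_leW T (B : T -> T -> nat) R R' :
  R <= R' -> rank_le B R -> rank_le B R'.
Proof.
by move=> le_R [J [U [V [cardJ BE]]]]; exists J, U, V; split=> //; apply: leq_trans le_R.
Qed.

Lemma eq_rank_le T (B B' : T -> T -> nat) R :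
  (forall u v, B u v = B' u v) -> rank_le B R -> rank_le B' R.
Proof.
by move=> eqB [J [U [V [cardJ BE]]]]; exists J, U, V; split=> // u v; rewrite -eqB.
Qed.

Lemma rank_le_outer T (f g : T -> nat) : rank_le (fun u v => f u * g v) 1.
Proof.
exists unit, (fun u _ => f u), (fun _ v => g v).
by split=> [|u v]; rewrite ?card_unit // big_const card_unit /= addn0.
Qed.

Lemma rank_le_cst T c : rank_le (fun _ _ : T => c) 1.
Proof. by apply: eq_rank_le (rank_le_outer (fun=> c) (fun=> 1)) => u v; rewrite muln1. Qed.

Lemma rank_le0 T : rank_le (fun _ _ : T => 0) 0.
Proof.
exists void, (fun _ _ => 0), (fun _ _ => 0).
by split=> [|u v]; rewrite ?card_void // big1.
Qed.

Lemma rank_leD T (B B' : T -> T -> nat) R R' :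
  rank_le B R -> rank_le B' R' -> rank_le (fun u v => B u v + B' u v) (R + R').
Proof.
move=> [J [U [V [cJ BE]]]] [J' [U' [V' [cJ' BE']]]].
exists (J + J')%type,
  (fun u k => match k with inl a => U u a | inr b => U' u b end),
  (fun k v => match k with inl a => V a v | inr b => V' b v end).
split=> [|u v]; first by rewrite card_sum leq_add.
by rewrite big_sumType BE BE'.
Qed.

(** Multiplying out the two sums indexes the entrywise product by pairs of coordinates. *)
Lemma rank_leM T (B B' : T -> T -> nat) R R' :
  rank_le B R -> rank_le B' R' -> rank_le (fun u v => B u v * B' u v) (R * R').
Proof.
move=> [J [U [V [cJ BE]]]] [J' [U' [V' [cJ' BE']]]].
exists (J * J')%type, (fun u k => U u k.1 * U' u k.2), (fun k v => V k.1 v * V' k.2 v).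
split=> [|u v]; first by rewrite card_prod leq_mul.
rewrite BE BE' big_distrlr pair_big /=.
by apply: eq_bigr => k _; rewrite mulnACA.
Qed.

Lemma rank_leX T (B : T -> T -> nat) R e :
  rank_le B R -> rank_le (fun u v => B u v ^ e) (R ^ e).
Proof.
move=> rB; elim: e => [|e IHe]; first exact: rank_le_cst.
by rewrite expnS; apply: eq_rank_le (rank_leM rB IHe) => u v; rewrite expnS.
Qed.

Lemma rank_le_sum T (I : Type) (s : seq I) (P : pred I) (B : I -> T -> T -> nat) (R : I -> nat) :
  (forall x, P x -> rank_le (B x) (R x)) ->
  rank_le (fun u v => \sum_(x <- s | P x) B x u v) (\sum_(x <- s | P x) R x).
Proof.
move=> rB; elim: s => [|x s IHs].
  by rewrite big_nil; apply: eq_rank_le (rank_le0 T) => u v; rewrite big_nil.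
rewrite big_cons; case: (boolP (P x)) => Px.
  by apply: eq_rank_le (rank_leD (rB x Px) IHs) => u v; rewrite big_cons Px.
by apply: eq_rank_le IHs => u v; rewrite big_cons (negPf Px).
Qed.

Lemma rank_le_prod T (I : eqType) (s : seq I) (B : I -> T -> T -> nat) (R : I -> nat) :
  (forall x, x \in s -> rank_le (B x) (R x)) ->
  rank_le (fun u v => \prod_(x <- s) B x u v) (\prod_(x <- s) R x).
Proof.
elim: s => [|x s IHs] rB.
  by rewrite big_nil; apply: eq_rank_le (rank_le_cst T 1) => u v; rewrite big_nil.
rewrite big_cons.
have rBs : rank_le (fun u v => \prod_(y <- s) B y u v) (\prod_(y <- s) R y).
  by apply: IHs => y ys; apply: rB; rewrite inE ys orbT.
by apply: eq_rank_le (rank_leM (rB x (mem_head x s)) rBs) => u v; rewrite big_cons.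
Qed.

(** * Binomial coefficients modulo primes and the OR polynomial *)

(* p divides C(w, i+1) = C(w-1, i) + C(w-1, i+1) for i+1 < p^j. *)
Lemma not_dvdn_bin_pred p j w i :
  prime p -> 0 < w -> p ^ j %| w -> i < p ^ j -> ~~ (p %| 'C(w.-1, i)).
Proof.
move=> p_pr w_gt0 pjw; elim: i => [_|i IHi lt_i].
  by rewrite bin0 dvdn1 neq_ltn prime_gt1 ?orbT.
apply/negP => dvd_bin.
(* Otherwise p^j, which divides w C(w-1, i) = (i+1) C(w, i+1), would divide i+1 < p^j. *)
have dvd_w : p %| 'C(w, i.+1).
  apply: contraLR lt_i => ndvd; rewrite -leqNgt dvdn_leq //.
  have : p ^ j %| i.+1 * 'C(w, i.+1).
    by rewrite -mul_bin_diag dvdn_mulr.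
  by rewrite Gauss_dvdl // coprimeXl // prime_coprime.
case/negP: (IHi (ltnW lt_i)).
by move: dvd_w; rewrite -(prednK w_gt0) binS dvdn_addr.
Qed.

(** With q the exact power of p in w, C(w, q) = (w/q) C(w-1, q-1), and p divides neither factor. *)
Lemma not_dvdn_bin_logn p w :
  prime p -> 0 < w -> ~~ (p %| 'C(w, p ^ logn p w)).
Proof.
move=> p_pr w_gt0; set q := p ^ logn p w.
have q_gt0 : 0 < q by rewrite expn_gt0 prime_gt0.
have qw : q %| w by apply: pfactor_dvdnn.
have binE : 'C(w, q) = w %/ q * 'C(w.-1, q.-1).
  apply/eqP; rewrite -(eqn_pmul2l q_gt0) mulnA [q * (_ %/ _)]mulnC divnK //.
  by have := mul_bin_diag w q.-1; rewrite prednK // => ->.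
rewrite binE Euclid_dvdM // negb_or.
rewrite (@not_dvdn_bin_pred p (logn p w)) // ?ltn_predL // andbT.
apply/negP => dvd_p.
have : p ^ (logn p w).+1 %| w.
  by rewrite expnS; have := dvdn_mul dvd_p (dvdnn q); rewrite divnK.
by rewrite pfactor_dvdn // ltnn.
Qed.

(* The factor at j is 1 - C(w, p^j)^(p-1) modulo p, written without subtraction;
   raising to the power m turns divisibility by p into divisibility by the whole
   power of p in m. *)
Definition or_poly (m : nat) (a : nat -> nat) (w : nat) : nat :=
  \prod_(p <- primes m)
    (\prod_(0 <= j < a p) (1 + p.-1 * 'C(w, p ^ j) ^ p.-1)) ^ m.

Lemma or_poly0 m a : or_poly m a 0 = 1.
Proof.
apply: big1_seq => p /andP[_]; rewrite mem_primes => /andP[p_pr _].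
rewrite big1 ?exp1n // => j _.
(* Since [0 ^ 0 = 1], the factor is 1 only because the exponent p - 1 is positive. *)
have p1 : 0 < p.-1 by rewrite -subn1 subn_gt0 prime_gt1.
by rewrite bin0n expn_eq0 (negPf (lt0n_neq0 (prime_gt0 p_pr))) exp0n // muln0.
Qed.

Lemma prod_primepow_dvdn (s : seq nat) (a : nat -> nat) w :
  uniq s -> all prime s -> (forall p, p \in s -> p ^ a p %| w) ->
  \prod_(p <- s) p ^ a p %| w.
Proof.
elim: s => [|p s IHs] /=; first by rewrite big_nil.
move=> /andP[p_s s_u] /andP[p_pr s_pr] dvd_w; rewrite big_cons Gauss_dvd.
  rewrite dvd_w ?mem_head //=; apply: IHs => // q qs.
  by apply: dvd_w; rewrite inE qs orbT.
rewrite big_seq; apply/(big_ind (fun z => coprime (p ^ a p) z)).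
- exact: coprimen1.
- by move=> x y cx cy; rewrite coprimeMr cx.
move=> q qs; rewrite coprimeXl // coprimeXr // prime_coprime //.
rewrite dvdn_prime2 // ?(allP s_pr q qs) //; by apply: contraNN p_s => /eqP ->.
Qed.

(** If every p^(a p) divided w, so would their product, which exceeds w. For a p that fails, j =
    [logn p w] lies below [a p], and by Fermat the factor at j is 1 + (p - 1) = 0 modulo p. *)
Lemma or_poly_dvd m a w :
  0 < m -> 0 < w -> w < \prod_(p <- primes m) p ^ a p ->
  exists2 p, p \in primes m & p ^ logn p m %| or_poly m a w.
Proof.
move=> m_gt0 w_gt0 lt_w.
have [/allP dvd_w | /allPn[p pm ndvd]] := boolP (all (fun p => p ^ a p %| w) (primes m)).
  have := prod_primepow_dvdn (primes_uniq m) _ dvd_w.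
  have -> : all prime (primes m) by apply/allP => p; rewrite mem_primes => /andP[].
  by move=> /(_ isT)/(dvdn_leq w_gt0); rewrite leqNgt lt_w.
exists p => //; rewrite /or_poly (big_rem p) //= dvdn_mulr //.
have p_pr : prime p by move: pm; rewrite mem_primes => /andP[].
have lt_a : logn p w < a p by rewrite ltnNge -pfactor_dvdn.
(* The outer power m is enough because [logn p m] < m. *)
apply: (@dvdn_trans (p ^ m)).
  by rewrite dvdn_exp2l // ltnW // ltn_logl.
apply: dvdn_exp2r; rewrite (big_cat_nat (n := logn p w)) ?(ltnW lt_a) //=.
rewrite dvdn_mull // big_ltn // dvdn_mulr //.
set c := 'C(_, _).
have c1 : c ^ p.-1 = 1 %[mod p].
  rewrite -totient_prime //; apply: Euler_exp_totient.
  by rewrite coprime_sym prime_coprime // not_dvdn_bin_logn.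
by rewrite /dvdn -modnDmr -modnMmr c1 modnMmr muln1 modnDmr add1n prednK ?prime_gt0 // modnn.
Qed.

(** * Hamming distance and the rank of its binomial coefficients *)

Definition hamming (I L : finType) (u v : {ffun I -> L}) : nat :=
  #|[set s | u s != v s]|.

Lemma hamming_refl (I L : finType) (u : {ffun I -> L}) : hamming u u = 0.
Proof. by apply: eq_card0 => s; rewrite inE eqxx. Qed.

Lemma hamming_gt0 (I L : finType) (u v : {ffun I -> L}) : u != v -> 0 < hamming u v.
Proof.
move=> neq_uv; rewrite card_gt0; apply: contraNneq neq_uv => D0.
apply/eqP/ffunP => s; apply/eqP/negPn/negP => us.
by have := in_set0 s; rewrite -D0 inE us.
Qed.

(** The coordinate is the letter c: in the sum of [u s = c] [c != v s] only c = u s can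
    contribute. *)
Lemma rank_le_neq (I L : finType) (s : I) :
  rank_le (fun u v : {ffun I -> L} => u s != v s : nat) #|L|.
Proof.
exists L, (fun u c => (u s == c) : nat), (fun c v => (c != v s) : nat).
split=> // u v; rewrite (bigD1 (u s)) //= eqxx mul1n big1 ?addn0 // => c.
by rewrite eq_sym => /negPf ->.
Qed.

(* Counting the q-subsets of the set of places where u and v differ. *)
Lemma rank_le_bin_hamming (I L : finType) q :
  rank_le (fun u v : {ffun I -> L} => 'C(hamming u v, q)) ((#|L| * #|I|) ^ q).
Proof.
(* [B S] is the indicator that u and v differ at every place of S. *)
pose B (S : {set I}) (u v : {ffun I -> L}) := \prod_(s <- enum S) (u s != v s).
have rB (S : {set I}) : #|S| == q -> rank_le (B S) (#|L| ^ q).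
  move=> /eqP <-; have /rank_leW : \prod_(s <- enum S) #|L| <= #|L| ^ #|S|.
    by rewrite big_enum prod_nat_const.
  by apply; apply: (rank_le_prod (fun s _ => rank_le_neq L s)).
have /rank_leW leR : \sum_(S : {set I} | #|S| == q) #|L| ^ q <= (#|L| * #|I|) ^ q.
  rewrite sum_nat_const expnMn mulnC leq_mul2l.
  have -> : #|[pred S : {set I} | #|S| == q]| = 'C(#|I|, q).
    by rewrite -card_draws cardsE.
  apply/orP; right; apply: (@leq_trans (#|I| ^_ q)).
    by rewrite -bin_ffact leq_pmulr // fact_gt0.
  elim: q {rB} => [|q IHq]; first by rewrite ffactn0.
  by rewrite ffactnSr expnSr leq_mul // leq_subr.
apply: eq_rank_le (leR _ _ (rank_le_sum (index_enum _) rB)) => u v.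
rewrite /hamming -cards_draws -sum1_card [RHS]big_mkcond [LHS]big_mkcond.
apply: eq_bigr => S _; rewrite !inE /B andbC; case: ifP => //= _.
case: ifP => [/subsetP sub | /negbT/subsetPn[s sS]].
  by rewrite big_enum big1 // => s /sub; rewrite inE => ->.
by rewrite inE negbK => /eqP us; rewrite big_enum (bigD1 s) //= us eqxx.
Qed.

(** * The matrix of the OR polynomial on words *)

(** The factor of [or_poly] at j will contribute p^(j+1) to the exponent of the rank. *)
Lemma sum_expnS_le p a : 1 < p -> \sum_(0 <= j < a) p ^ j.+1 <= 2 * p ^ a.
Proof.
move=> p_gt1; elim: a => [|a IHa]; first by rewrite big_nil.
rewrite big_nat_recr //= mul2n -addnn leq_add2r (leq_trans IHa) //.
by rewrite expnS leq_mul2r p_gt1 orbT.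
Qed.

(** For X = |L| |I|, the factor at j has rank at most 1 + X^(p^j (p-1)) <= X^(p^(j+1)). Over j the
    exponents add up to at most 2 p^(a p) <= 2 p t p <= 2 m t p; since the hypothesis already gives
    p^(a p) <= p t, the bound is in fact 2 p t <= 2 m t. The power m and the number of primes supply
    the remaining factors. *)
Lemma rank_le_or_poly (I L : finType) m a t :
  1 < #|L| * #|I| -> (forall p, p \in primes m -> p ^ a p <= p * t) ->
  rank_le (fun u v : {ffun I -> L} => or_poly m a (hamming u v))
    ((#|L| * #|I|) ^ (2 * m * m * t * size (primes m))).
Proof.
set X := #|L| * #|I| => X_gt1 le_a.
have rp p : p \in primes m -> rank_le (fun u v : {ffun I -> L} =>
    (\prod_(0 <= j < a p) (1 + p.-1 * 'C(hamming u v, p ^ j) ^ p.-1)) ^ m)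
    (X ^ (2 * m * m * t)).
  move=> pm; have [p_pr m_gt0 p_m] : [/\ prime p, 0 < m & p %| m].
    by move: pm; rewrite mem_primes => /and3P.
  have p_gt1 := prime_gt1 p_pr.
  apply: (@rank_leW _ _ ((X ^ (2 * m * t)) ^ m)).
    by rewrite -expnM leq_exp2l // mulnAC.
  apply: rank_leX.
  apply: (@rank_leW _ _ (X ^ \sum_(0 <= j < a p) p ^ j.+1)).
    rewrite leq_exp2l //; apply: leq_trans (sum_expnS_le _ p_gt1) _.
    rewrite -mulnA leq_mul2l /=; apply: leq_trans (le_a p pm) _.
    by rewrite leq_mul2r dvdn_leq ?orbT.
  rewrite expn_sum; apply: rank_le_prod => j _.
  apply: (@rank_leW _ _ (1 + 1 * (X ^ p ^ j) ^ p.-1)); last first.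
    apply: rank_leD (rank_le_cst _ _) _; apply: rank_leM (rank_le_cst _ _) _.
    exact/rank_leX/rank_le_bin_hamming.
  rewrite mul1n -expnM; have pj : 0 < p ^ j by rewrite expn_gt0 ltnW.
  (* The summand 1 is absorbed by one more factor X >= 2. *)
  apply: (@leq_trans (X ^ (p ^ j * p.-1).+1)).
    rewrite expnS; apply: (@leq_trans (2 * X ^ (p ^ j * p.-1))).
      by rewrite mul2n -addnn leq_add2r expn_gt0 ltnW.
    by rewrite leq_mul2r X_gt1 orbT.
  by rewrite leq_exp2l // expnSr -[X in _ <= _ * X](prednK (ltnW p_gt1)) mulnS
     -addn1 addnC leq_add2r.
apply: rank_leW (rank_le_prod rp).
by rewrite big_const_seq count_predT iter_muln_1 -expnM.
Qed.

(** Distinct indices get distinct words, at distance between 1 and K. Each p^(a p) is at least t, so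
    their product is at least t^r > K, where r is the number of primes. *)
Lemma codiagonal_matrix m n K h t :
  1 < m -> n <= h ^ K -> 0 < t -> K < t ^ size (primes m) -> 1 < h * K ->
  exists B : 'I_n -> 'I_n -> nat,
  [/\ forall i, B i i = 1,
      forall i j, i != j -> exists2 p, p \in primes m & p ^ logn p m %| B i j &
      rank_le B ((h * K) ^ (2 * m * m * t * size (primes m)))].
Proof.
move=> m_gt1 le_n t_gt0 lt_K hK.
pose W := {ffun 'I_K -> 'I_h}.
have cardW : n <= #|{: W}| by rewrite card_ffun !card_ord.
pose c (i : 'I_n) : W := enum_val (widen_ord cardW i).
have c_inj : injective c by move=> i j /enum_val_inj[] /val_inj.
(* The least exponent with t <= p^(a p); minimality keeps p^(a p) below p t. *)
pose a p := up_log p t.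
have a_le p : p \in primes m -> t <= p ^ a p <= p * t.
  rewrite mem_primes => /andP[/prime_gt1 p_gt1 _].
  rewrite /a up_logP //=; case: (ltngtP t 1) => [|t_gt1|->].
  - by rewrite ltnNge t_gt0.
  - have a_gt0 : 0 < up_log p t by rewrite up_log_gt0 p_gt1.
    by rewrite -(prednK a_gt0) expnS leq_mul2l ltnW ?orbT // up_log_gtn.
  by rewrite up_log1 expn0 muln1 ltnW.
exists (fun i j => or_poly m a (hamming (c i) (c j))); split.
- by move=> i; rewrite hamming_refl or_poly0.
- move=> i j neq_ij; apply: or_poly_dvd; first exact: ltnW.
    by apply: hamming_gt0; apply: contraNneq neq_ij => /c_inj ->.
  apply: (@leq_ltn_trans K); first by rewrite -[X in _ <= X]card_ord max_card.
  apply: leq_trans lt_K _.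
  rewrite -iter_muln_1 -[size _](count_predT (primes m)) -big_const_seq.
  by rewrite big_seq [leqRHS]big_seq leq_prod // => p /a_le /andP[].
have hKI : 1 < #|'I_h| * #|'I_K| by rewrite !card_ord.
have a_le' p : p \in primes m -> p ^ a p <= p * t by move=> /a_le/andP[].
have [J [U [V [cJ BE]]]] := rank_le_or_poly hKI a_le'.
exists J, (fun i => U (c i)), (fun k j => V k (c j)); split=> //.
by rewrite !card_ord in cJ.
Qed.

(** * Choice of alphabet, word length and threshold *)

(** Here l is about log n and s about log log n. The alphabet has 2^s letters, K is about l / s, and
    t is about the r-th root of K. The product s t measures the exponent of the final rank in base
    2. *)
Lemma word_parameters r n : 0 < r ->
  let l := (trunc_log 2 n).+1 in let s := (trunc_log 2 l).+1 in
  exists h K t, [/\ n <= h ^ K, 0 < t, K < t ^ r, 1 < h * K &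
    h * K <= 2 ^ (2 * s) /\ (s * t) ^ r <= 2 ^ r.+1 * l * s ^ r.-1].
Proof.
move=> r_gt0 l s; pose K := (l %/ s).+1.
have lt_l : l < 2 ^ s by apply: trunc_log_ltn.
have le_sl : s <= l.
  rewrite ltnS -(leq_exp2l (m := 2)) //.
  by apply: leq_trans (trunc_logP _ _) _; rewrite // ltn_expl.
(* The lower bound on s K yields enough words, the upper one the final estimate. *)
have lK : l <= s * K by rewrite ltnW // mulnC -ltn_divLR // ltnSn.
have Kl : s * K <= 2 * l by rewrite mulnS addnC mul2n -addnn leq_add // mulnC leq_trunc_div.
have ext : exists t, K < t ^ r.
  by exists K.+1; rewrite -[X in X < _]expn1 (leq_trans (n := K.+1 ^ 1)) // leq_pexp2l.
case: (ex_minnP ext) => t lt_K min_t.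
have t_gt1 : 1 < t.
  rewrite ltnNge; apply: contraTN lt_K => t_le1; rewrite -leqNgt.
  by rewrite (leq_trans (n := 1 ^ r)) ?leq_exp2r ?exp1n.
(* By minimality t - 1 fails; as t >= 2, t <= 2 (t - 1) carries the bound over to t at the cost of
   2^r. *)
have le_K : t.-1 ^ r <= K.
  by rewrite leqNgt; apply/negP => /min_t; rewrite -ltnS prednK ?ltnn // ltnW.
exists (2 ^ s), K, t; split=> //.
- by rewrite -expnM (leq_trans (ltnW (trunc_log_ltn n (ltnSn 1)))) // leq_exp2l.
- exact: ltnW.
- by rewrite (leq_trans (n := 2 ^ s)) ?leq_pmulr // -[2]expn1 leq_exp2l.
split.
  rewrite mul2n -addnn expnD leq_mul2l; apply/orP; right.
  by apply: leq_trans lt_l; rewrite ltnS leq_div.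
have t2 : t <= 2 * t.-1 by lia.
have st : (s * t) ^ r <= s ^ r * (2 ^ r * K).
  rewrite expnMn leq_mul2l (leq_trans (n := (2 * t.-1) ^ r)) ?orbT ?leq_exp2r //.
  by rewrite expnMn leq_mul2l le_K orbT.
apply: leq_trans st _.
rewrite -{1}(prednK r_gt0) expnS -/s (_ : _ * _ = 2 ^ r * (s * K) * s ^ r.-1); last by nia.
by rewrite leq_mul2r expnSr -[2 ^ r * 2 * l]mulnA leq_mul2l Kl !orbT.
Qed.

(** * Bilinear forms as polynomials and the representation property *)

Section Polynomials.
Import GRing.Theory.
Local Open Scope ring_scope.

Definition bilinear_form (A : comNzRingType) (n : nat) (B : 'I_n -> 'I_n -> A) :
  {mpoly A[n + n]} := \sum_(i < n) \sum_(j < n) B i j *: (xvar A i * yvar A j).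

(** The support of the monomial x_i y_j, in the shape in which [coef_set] reads coefficients. *)
Definition xy_pair (n : nat) (i j : 'I_n) : {set 'I_(n + n)} :=
  [set lshift n i; rshift n j].

Lemma xy_pair_inj n (i j i' j' : 'I_n) :
  xy_pair i j = xy_pair i' j' -> i = i' /\ j = j'.
Proof.
move=> /setP eqS; split.
  have := eqS (lshift n i); rewrite !inE eqxx !eq_lrshift !orbF.
  by rewrite (inj_eq (@lshift_inj n n)) => /esym/eqP.
have := eqS (rshift n j); rewrite !inE eqxx !eq_rlshift /=.
by rewrite (inj_eq (@rshift_inj n n)) => /esym/eqP.
Qed.

Lemma xvar_yvarE (A : comNzRingType) n (i j : 'I_n) :
  xvar A i * yvar A j = 'X_[mesym1 (xy_pair i j)].
Proof.
rewrite /xvar /yvar -mpolyXD; congr 'X_[_]; apply/mnmP => k.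
rewrite mnmDE !mnm1E mnmE !inE ![_ == k]eq_sym.
by case: eqP => [-> |]; rewrite ?eq_lrshift.
Qed.

Section BilinearForm.
Variables (A : comNzRingType) (n : nat).
Implicit Types B : 'I_n -> 'I_n -> A.

Lemma coef_bilinear_form B i j : coef_set (bilinear_form B) (xy_pair i j) = B i j.
Proof.
rewrite /coef_set /bilinear_form raddf_sum (bigD1 i) //= raddf_sum (bigD1 j) //=.
rewrite xvar_yvarE mcoeffZ mcoeffX eqxx mulr1 !big1 ?addr0 // => [i' ne|j' ne].
  rewrite raddf_sum big1 // => j' _; rewrite /= xvar_yvarE mcoeffZ mcoeffX.
  case: eqP => [/inj_mesym1/xy_pair_inj[eqi _]|]; last by rewrite mulr0.
  by rewrite eqi eqxx in ne.
rewrite /= xvar_yvarE mcoeffZ mcoeffX.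
case: eqP => [/inj_mesym1/xy_pair_inj[_ eqj]|]; last by rewrite mulr0.
by rewrite eqj eqxx in ne.
Qed.

Lemma mem_msupp_bilinear_form B mon :
  mon \in msupp (bilinear_form B) -> exists i j, mon = mesym1 (xy_pair i j).
Proof.
have [/existsP[i /existsP[j /eqP ->]] _| nex] :=
    boolP [exists i, exists j, mon == mesym1 (xy_pair i j)]; first by exists i, j.
rewrite mcoeff_msupp /bilinear_form raddf_sum big1 ?eqxx // => i _.
rewrite raddf_sum big1 // => j _; rewrite /= xvar_yvarE mcoeffZ mcoeffX.
case: eqP => [eqm|]; last by rewrite mulr0.
by case/existsP: nex; exists i; apply/existsP; exists j; rewrite eqm.
Qed.

Lemma coef_bilinear_form_eq0 B I :
  (forall i j, I <> xy_pair i j) -> coef_set (bilinear_form B) I = 0.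
Proof.
move=> neqI; apply/eqP; rewrite mcoeff_eq0; apply/negP.
by case/mem_msupp_bilinear_form => i [j /inj_mesym1/neqI].
Qed.

Lemma multilinear_bilinear_form B : multilinear (bilinear_form B).
Proof.
by move=> mon /mem_msupp_bilinear_form[i [j ->]] k; rewrite mnmE leq_b1.
Qed.

Lemma msize_bilinear_form B i j : B i j != 0 -> msize (bilinear_form B) = 3%N.
Proof.
have deg i' j' : mdeg (mesym1 (@xy_pair n i' j')) = 2%N.
  by rewrite mdeg_mesym1 cards2 eq_lrshift.
move=> Bij; apply/eqP; rewrite eqn_leq; apply/andP; split; last first.
  by rewrite -(deg i j) msize_mdeg_lt // mcoeff_msupp [_@__]coef_bilinear_form.
rewrite msizeE; apply/bigmax_leqP_seq => mon mon_in _.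
by have [i' [j' ->]] := mem_msupp_bilinear_form mon_in; rewrite deg.
Qed.

Lemma dot_productE : dot_product A n = bilinear_form (fun i j => (i == j)%:R).
Proof.
apply: eq_bigr => i _; rewrite (bigD1 i) //= eqxx scale1r big1 ?addr0 // => j ne.
by rewrite eq_sym (negPf ne) scale0r.
Qed.

End BilinearForm.

(** Diagonal coefficients agree exactly. Elsewhere the dot product has coefficient 0 and the form
    vanishes modulo some prime power of m, which gives both conditions at once. A diagonal entry,
    present as n > 0, makes the degree exactly 2. *)
Lemma bilinear_form_repr m n (B : 'I_n -> 'I_n -> nat) :
  (1 < m)%N -> (0 < n)%N -> (forall i, B i i = 1%N) ->
  (forall i j, i != j -> exists2 p, p \in primes m & p ^ logn p m %| B i j)%N ->
  degree2_one_a_strong_repr (dot_product 'Z_m n)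
    (bilinear_form (fun i j => (B i j)%:R)).
Proof.
move=> m_gt1 n_gt0 B1 B0.
(* An arbitrary prime of m, used wherever the two coefficients are equal. *)
have [p0 p0m] : exists p, p \in primes m
  by exists (pdiv m); rewrite mem_primes pdiv_prime // ltnW // pdiv_dvd.
have zmodE k p : ((k%:R : 'Z_m) = k %[mod p ^ logn p m])%N.
  by rewrite val_Zp_nat // modn_dvdm // pfactor_dvdnn.
split; last first.
  pose i0 := Ordinal n_gt0.
  by apply: (@msize_bilinear_form _ _ _ i0 i0); rewrite B1 oner_neq0.
have coefP I : (exists2 i, I = xy_pair i i & coef_set (dot_product 'Z_m n) I =
      coef_set (bilinear_form (fun i j => (B i j)%:R : 'Z_m)) I) \/
    coef_set (dot_product 'Z_m n) I = 0 /\ exists2 p, p \in primes m &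
      ((coef_set (bilinear_form (fun i j => (B i j)%:R : 'Z_m)) I : nat) = 0
        %[mod p ^ logn p m])%N.
  have [/existsP[i /existsP[j /eqP ->]] | nex] :=
    boolP [exists i, exists j, I == xy_pair i j].
    rewrite dot_productE !coef_bilinear_form.
    have [<- | ne] := eqVneq i j; [left | right].
      by exists i; rewrite // B1.
    split=> //; have [p pm dvd] := B0 i j ne; exists p => //.
    by rewrite zmodE mod0n; apply/eqP.
  have neqI i j : I <> xy_pair i j.
    by move=> eqI; case/existsP: nex; exists i; apply/existsP; exists j; rewrite eqI.
  by right; rewrite dot_productE !coef_bilinear_form_eq0 //; split=> //; exists p0.
split; [split|].
- by rewrite dot_productE; apply: multilinear_bilinear_form.
- exact: multilinear_bilinear_form.
- move=> I; case: (coefP I) => [[i _ eqc]|[f0 [p pm g0]]].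
    by exists p0; rewrite // /coef_congr eqc.
  by exists p; rewrite // /coef_congr f0 g0.
move=> I [p pm ncongr]; case: (coefP I) => [[i _ eqc]|[]//].
by case: ncongr; rewrite /coef_congr eqc.
Qed.

(** * Straight-line computations and circuits from a factorization *)

Section Computation.
Variables (A : comNzRingType) (N : nat).

(** Quantifying over all computations [s] and keeping their results lets such polynomials be
    appended one after another. *)
Definition mult_free (f : {mpoly A[N]}) : Prop :=
  forall s k, slp s k -> exists s', [/\ slp s' k, {subset s <= s'} & f \in s'].

Lemma mult_free_linear (I : Type) (r : seq I) (c : I -> A) (v : I -> 'I_N) :
  (0 < N)%N -> mult_free (\sum_(i <- r) c i *: 'X_(v i)).
Proof.
move=> N_gt0; elim: r => [|i r IHr] s k slp_s.
  (* The zero polynomial must itself be computed, as 0 times some variable; hence N > 0. *)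
  rewrite big_nil; pose x : {mpoly A[N]} := 'X_(Ordinal N_gt0).
  exists (0 *: x :: x :: s); split; last by rewrite scale0r mem_head.
    by apply: slp_scale (mem_head _ _); apply: slp_var.
  by move=> f fs; rewrite !inE fs !orbT.
have [s1 [slp1 sub1 in1]] := IHr s k slp_s.
pose x : {mpoly A[N]} := 'X_(v i); rewrite big_cons.
exists (c i *: x + \sum_(j <- r) c j *: 'X_(v j) :: c i *: x :: x :: s1); split.
- apply: slp_add; rewrite ?inE ?eqxx ?in1 ?orbT //.
  by apply: slp_scale (mem_head _ _); apply: slp_var.
- by move=> f /sub1 fs; rewrite !inE fs !orbT.
exact: mem_head.
Qed.

Lemma computable_sum_mul (J : Type) (r : seq J) (f g : J -> {mpoly A[N]}) :
  (0 < N)%N -> (forall x, mult_free (f x)) -> (forall x, mult_free (g x)) ->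
  computable_with_mults (\sum_(x <- r) f x * g x) (size r).
Proof.
move=> N_gt0 ff fg; elim: r => [|x r [s slp_s in_s]].
  (* A linear form without terms, indexed by [void], provides the empty sum. *)
  have [s [slp_s _ in_s]] := @mult_free_linear void [::] (fun=> 0) (of_void _)
    N_gt0 [::] 0%N (slp_nil _ _).
  by exists s => //; move: in_s; rewrite !big_nil.
have [s1 [slp1 sub1 f1]] := ff x _ _ slp_s.
have [s2 [slp2 sub2 g2]] := fg x _ _ slp1.
rewrite big_cons /=; exists (f x * g x + \sum_(y <- r) f y * g y :: f x * g x :: s2).
  apply: slp_add; rewrite ?inE ?eqxx ?(sub2 _ (sub1 _ in_s)) ?orbT //.
  by apply: slp_mul => //; apply: sub2.
exact: mem_head.
Qed.

End Computation.

Section RankComputation.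
Variables (A : comNzRingType) (n : nat) (B : 'I_n -> 'I_n -> nat) (R : nat).
Hypothesis rB : rank_le B R.

Let g : {mpoly A[n + n]} := bilinear_form (fun i j => (B i j)%:R).

Lemma bilinear_form_rankE (J : finType) (U : 'I_n -> J -> nat) (V : J -> 'I_n -> nat) :
  (forall i j, B i j = (\sum_k U i k * V k j)%N) ->
  g = \sum_k (\sum_(i < n) (U i k)%:R *: xvar A i) * (\sum_(j < n) (V k j)%:R *: yvar A j).
Proof.
move=> BE; under [RHS]eq_bigr => k _ do rewrite big_distrlr /=.
rewrite exchange_big; apply: eq_bigr => i _.
rewrite exchange_big; apply: eq_bigr => j _ /=.
rewrite BE natr_sum scaler_suml; apply: eq_bigr => k _.
by rewrite natrM -scalerAl -scalerAr scalerA.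
Qed.

Lemma bilinear_form_mults : (0 < n)%N ->
  exists2 k, computable_with_mults g k & (k <= R)%N.
Proof.
move=> n_gt0; have [J [U [V [cJ BE]]]] := rB.
exists #|J| => //; rewrite (bilinear_form_rankE BE) cardE -[index_enum _]enumT.
by apply: computable_sum_mul => [|k|k]; try apply: mult_free_linear; rewrite addn_gt0 n_gt0.
Qed.

Lemma bilinear_form_size :
  exists2 k, computable_with_size g k & (k <= 3 * R + 1)%N.
Proof.
have [J [U [V [cJ BE]]]] := rB.
(* Each coordinate of the factorization gets one x-gate, one y-gate and one product gate; [enum_val]
   numbers the coordinates. *)
pose c := @BilinearSPS A n #|J| #|J| #|J|
  (\matrix_(k, i) (U i (enum_val k))%:R) (\matrix_(k, j) (V (enum_val k) j)%:R)
  (fun k => (k, k)) (fun=> 1).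
exists (circuit_size c); last by rewrite leq_add2r !mulSn addnA addn0 !leq_add.
exists c => //; rewrite (bilinear_form_rankE BE) /circuit_value /=.
rewrite [RHS](reindex (@enum_val J predT)) /=; last first.
  by apply: onW_bij; apply: enum_val_bij.
apply: eq_bigr => k _; rewrite scale1r /xform /yform.
by congr (_ * _); apply: eq_bigr => i _; rewrite mxE.
Qed.

End RankComputation.

End Polynomials.

(** * Real estimates for the rate *)

Section Asymptotics.
Local Open Scope R_scope.

Lemma INR_leq a b : (a <= b)%N -> INR a <= INR b.
Proof. by move/leP; apply: le_INR. Qed.

Lemma INR_muln a b : INR (a * b)%N = INR a * INR b.
Proof. by rewrite -multE mult_INR. Qed.

Lemma INR_expn a b : INR (a ^ b)%N = INR a ^ b.
Proof. by elim: b => [|b IHb] //=; rewrite expnS INR_muln IHb. Qed.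

Lemma ln2_ge : / 2 <= ln 2.
Proof. by have := ln_lt_2; lra. Qed.

Lemma ln_le_pred x : 0 < x -> ln x <= x - 1.
Proof.
move=> x_gt0; have := exp_ineq1_le (ln x).
by rewrite exp_ln //; lra.
Qed.

Lemma ln_le_mono x y : 0 < x -> x <= y -> ln x <= ln y.
Proof. by move=> x_gt0 [/(ln_increasing _ _ x_gt0)|->]; [left | right]. Qed.

Lemma exp_le_mono x y : x <= y -> exp x <= exp y.
Proof. by move=> [/exp_increasing|->]; [left | right]. Qed.

Lemma trunc_log_le_ln n : (0 < n)%N -> INR (trunc_log 2 n) <= 2 * ln (INR n).
Proof.
move=> n_gt0; have := INR_leq (trunc_logP (ltnSn 1) n_gt0); rewrite INR_expn => le_n.
set k := trunc_log 2 n in le_n *.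
have pow_gt0 : 0 < INR 2 ^ k by apply: pow_lt; simpl; lra.
have := ln_le_mono pow_gt0 le_n.
have -> : INR 2 = 2 by simpl; lra.
rewrite ln_pow; last lra.
have := pos_INR k; have := ln2_ge; nra.
Qed.

(** As 27 = 3^3 >= e^3, ln n >= 3 >= e. *)
Lemma lnln_ge1 n : (27 <= n)%N -> 1 <= ln (INR n) /\ 1 <= ln (ln (INR n)).
Proof.
move=> /INR_leq le_n.
have n27 : 27 <= INR n by apply: Rle_trans le_n; rewrite /=; lra.
have le3 : exp 1 <= ln (INR n).
  apply: Rle_trans exp_le_3 _; rewrite -[3]ln_exp; apply: ln_le_mono; first exact: exp_pos.
  have -> : 3 = 1 + 1 + 1 by lra.
  rewrite !exp_plus; have := exp_le_3; have := exp_pos 1; nra.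
have e1 : 1 <= exp 1 by have := exp_ineq1_le 1; lra.
split; first lra.
by rewrite -[X in X <= _]ln_exp; apply: ln_le_mono => //; lra.
Qed.

Lemma rate_pow r n : (0 < r)%N -> (27 <= n)%N ->
  rate r n ^ r = ln (INR n) * ln (ln (INR n)) ^ r.-1.
Proof.
move=> r_gt0 /lnln_ge1[L1 LL1]; have r0 : INR r <> 0 by apply: not_0_INR; lia.
have U_gt0 : 0 < ln (INR n) * ln (ln (INR n)) ^ r.-1.
  by apply: Rmult_lt_0_compat; [lra | apply: pow_lt; lra].
rewrite -Rpower_pow; last exact: exp_pos.
rewrite /rate Rpower_mult (_ : 1 / INR r * INR r = 1); last by field.
by rewrite Rpower_1.
Qed.

Lemma pow_le_inv r x y : (0 < r)%N -> 0 <= x -> 0 <= y -> x ^ r <= y ^ r -> x <= y.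
Proof.
move=> r_gt0 x0 y0 le_r; apply: Rnot_lt_le => lt_yx.
have : y ^ r < x ^ r.
  elim: r r_gt0 {le_r} => // r IHr _; case: (posnP r) => [-> | r_gt0]; first by rewrite !pow_1.
  by have := IHr r_gt0; have := pow_le _ r y0; rewrite /=; nra.
by lra.
Qed.

Lemma rate_ge1 r n : (0 < r)%N -> (27 <= n)%N -> 1 <= rate r n.
Proof.
move=> r_gt0 n27; have [L1 LL1] := lnln_ge1 n27.
apply: (pow_le_inv r_gt0); [lra | by left; apply: exp_pos|].
rewrite pow1 rate_pow //; have := pow_R1_Rle _ r.-1 LL1; nra.
Qed.

(** From l <= 3 ln n, s <= 7 ln ln n and 2^(r+1) = 4 2^(r-1), the r-th power of e is at most 12
    2^(r-1) 7^(r-1) times that of the rate. This is below 84^r, since 84 = 12 7. *)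
Lemma rate_bound r n e : (0 < r)%N -> (27 <= n)%N ->
  let l := (trunc_log 2 n).+1 in let s := (trunc_log 2 l).+1 in
  (e ^ r <= 2 ^ r.+1 * l * s ^ r.-1)%N -> INR e <= 84 * rate r n.
Proof.
move=> r_gt0 n27 l s /INR_leq; have [L1 LL1] := lnln_ge1 n27.
rewrite !INR_muln !INR_expn => le_e.
have n_gt0 : (0 < n)%N by apply: leq_trans n27.
have l_le : INR l <= 3 * ln (INR n).
  by rewrite S_INR; have := trunc_log_le_ln n_gt0; lra.
have l_gt0 : 0 < INR l by apply: lt_0_INR; lia.
have s_le : INR s <= 7 * ln (ln (INR n)).
  rewrite S_INR; have := @trunc_log_le_ln l isT; have := ln_le_mono l_gt0 l_le.
  rewrite ln_mult; [|lra|lra]; have : ln 3 <= 3 - 1 by apply: ln_le_pred; lra.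
  lra.
apply: (pow_le_inv r_gt0); first exact: pos_INR.
  by have := rate_ge1 r_gt0 n27; lra.
apply: Rle_trans le_e _; rewrite Rpow_mult_distr rate_pow //.
have le_s : INR s ^ r.-1 <= 7 ^ r.-1 * ln (ln (INR n)) ^ r.-1.
  by rewrite -Rpow_mult_distr; apply: pow_incr; split; [apply: pos_INR|].
have -> : INR 2 ^ r.+1 = 4 * 2 ^ r.-1.
  by rewrite (_ : INR 2 = 2) // -{1}(prednK r_gt0) -!tech_pow_Rmult; lra.
have -> : 84 ^ r = 84 * (12 ^ r.-1 * 7 ^ r.-1).
  by rewrite -{1}(prednK r_gt0) -tech_pow_Rmult -Rpow_mult_distr (_ : 12 * 7 = 84) //; lra.
have le12 : 2 ^ r.-1 <= 12 ^ r.-1 by apply: pow_incr; lra.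
have p2 : 0 <= 2 ^ r.-1 by apply: pow_le; lra.
have ps : 0 <= INR s ^ r.-1 by apply: pow_le; apply: pos_INR.
apply: Rle_trans (Rmult_le_compat _ _ _ _ _ ps
  (Rmult_le_compat _ _ _ _ _ (Rlt_le _ _ l_gt0) (Rmult_le_compat_l 4 _ _ _ le12) l_le) le_s) _.
- by apply: Rmult_le_pos; lra.
- by lra.
- by lra.
set x := 12 ^ _ in le12 *; set y := 7 ^ _ in le_s *; set z := ln _ ^ _ in le_s *.
have yz : 0 <= y * z by lra.
have Q0 : 0 <= x * ln (INR n) * (y * z).
  by apply: Rmult_le_pos yz; apply: Rmult_le_pos; lra.
apply: (Rle_trans _ (84 * (x * ln (INR n) * (y * z)))); last by right; ring.
apply: (Rle_trans _ (12 * (x * ln (INR n) * (y * z)))); last lra.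
by right; ring.
Qed.

(** The cost is at most 2^(2 D e + 2), where e <= 84 [rate r n] and ln 2 <= 1; the summand 2 is
    absorbed because the rate is at least 1. *)
Lemma cost_bound r n e D R k : (0 < r)%N -> (27 <= n)%N ->
  (k <= 3 * R + 1)%N -> (R <= 2 ^ (2 * D * e))%N ->
  (e ^ r <= 2 ^ r.+1 * (trunc_log 2 n).+1 *
            (trunc_log 2 (trunc_log 2 n).+1).+1 ^ r.-1)%N ->
  INR k <= exp ((INR (168 * D) + 2) * Rabs (rate r n)).
Proof.
move=> r_gt0 n27 le_k le_R /(rate_bound r_gt0 n27) le_e.
have rate1 := rate_ge1 r_gt0 n27; rewrite Rabs_pos_eq; last lra.
have {le_k le_R} /INR_leq : (k <= 2 ^ (2 * D * e + 2))%N.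
  apply: leq_trans le_k _; rewrite expnD.
  by have : (0 < 2 ^ (2 * D * e))%N; [rewrite expn_gt0 | lia].
move=> le_k; apply: Rle_trans le_k _; rewrite INR_expn.
have two : INR 2 = 2 by [].
rewrite two -Rpower_pow; last lra.
apply: exp_le_mono.
rewrite -plusE plus_INR !INR_muln.
have ln2 : ln 2 <= 1 by have := @ln_le_pred 2; lra.
have ln20 := ln2_ge; have D0 := pos_INR D; have e0 := pos_INR e.
have -> : INR 168 = 2 * 84 by rewrite INR_IZR_INZ /=; lra.
rewrite two; have : INR D * INR e <= INR D * (84 * rate r n) by apply: Rmult_le_compat_l.
have x0 : 0 <= INR D * INR e by apply: Rmult_le_pos.
move=> le_x; apply: (Rle_trans _ (2 * INR D * INR e + 2)); last lra.
rewrite -[X in _ <= X]Rmult_1_r; apply: Rmult_le_compat_l => //; lra.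
Qed.

Lemma rate_twoE n : (27 <= n)%N%N -> rate 2 n = rate_two n.
Proof.
move=> /lnln_ge1[L1 LL1]; rewrite /rate /rate_two /= Rmult_1_r.
rewrite (_ : 1 / (1 + 1) = / 2); last by lra.
by rewrite Rpower_sqrt //; apply: Rmult_lt_0_compat; lra.
Qed.

End Asymptotics.

(** * Assembling the bounds *)

Lemma size_primes_gt0 m : 1 < m -> 0 < size (primes m).
Proof.
move=> m_gt1; have : pdiv m \in primes m by rewrite mem_primes pdiv_prime // ltnW // pdiv_dvd.
by case: (primes m).
Qed.

Lemma dot_product_repr m n : 1 < m -> 0 < n ->
  let r := size (primes m) in let D := 2 * m * m * r in
  let l := (trunc_log 2 n).+1 in let s := (trunc_log 2 l).+1 in
  exists (g : {mpoly 'Z_m[n + n]}) (R e : nat),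
    [/\ degree2_one_a_strong_repr (dot_product 'Z_m n) g,
      exists2 k, computable_with_mults g k & k <= R,
      exists2 k, computable_with_size g k & k <= 3 * R + 1 &
      R <= 2 ^ (2 * D * e) /\ e ^ r <= 2 ^ r.+1 * l * s ^ r.-1].
Proof.
move=> m_gt1 n_gt0 r D l s.
have r_gt0 : 0 < r by apply: size_primes_gt0.
have [h [K [t [le_n t_gt0 lt_K hK [le_hK le_st]]]]] := word_parameters n r_gt0.
have [B [B1 B0 rB]] := codiagonal_matrix m_gt1 le_n t_gt0 lt_K hK.
exists (bilinear_form (fun i j => (B i j)%:R)%R).
(* With h K <= 2^(2 s), this rank is at most 2^(2 D e) for e = s t. *)
exists ((h * K) ^ (2 * m * m * t * r)), (s * t); split=> //.
- exact: bilinear_form_repr.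
- exact: bilinear_form_mults.
- exact: bilinear_form_size.
split=> //; have -> : 2 * D * (s * t) = 2 * s * (2 * m * m * t * r) by rewrite /D; lia.
by rewrite [2 ^ _]expnM leq_exp2r // !muln_gt0 t_gt0 r_gt0 (ltnW m_gt1).
Qed.

(** Both costs must concern the same polynomials, so one polynomial per n is chosen that meets both
    bounds. *)
Lemma dot_product_expO m : 1 < m ->
  exists g : forall n : nat, {mpoly 'Z_m[n + n]},
    [/\ forall n : nat, 0 < n ->
          degree2_one_a_strong_repr (dot_product 'Z_m n) (g n),
        expO (rate (size (primes m))) (fun n k => computable_with_mults (g n) k) &
        expO (rate (size (primes m))) (fun n k => computable_with_size (g n) k)].
Proof.
move=> m_gt1; set r := size (primes m); pose D := 2 * m * m * r.
have r_gt0 := size_primes_gt0 m_gt1; rewrite -/r in r_gt0.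
pose good n (g : {mpoly 'Z_m[n + n]}) := exists R e : nat,
    [/\ degree2_one_a_strong_repr (dot_product 'Z_m n) g,
      exists2 k, computable_with_mults g k & k <= R,
      exists2 k, computable_with_size g k & k <= 3 * R + 1 &
      R <= 2 ^ (2 * D * e) /\
      e ^ r <= 2 ^ r.+1 * (trunc_log 2 n).+1 * (trunc_log 2 (trunc_log 2 n).+1).+1 ^ r.-1].
have ex_g n : {g : {mpoly 'Z_m[n + n]} | 0 < n -> good n g}.
  apply: constructive_indefinite_description.
  (* The value at n = 0 is a default. *)
  have [->|n_gt0] := posnP n; first by exists 0%R.
  by have [g gP] := dot_product_repr m_gt1 n_gt0; exists g.
have expO_cost cost : (forall n, 0 < n -> good n (sval (ex_g n)) ->
    forall R, (exists2 k, computable_with_mults (sval (ex_g n)) k & k <= R) ->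
    (exists2 k, computable_with_size (sval (ex_g n)) k & k <= 3 * R + 1) ->
    exists2 k, cost n k & k <= 3 * R + 1) -> expO (rate r) cost.
  move=> costP; exists (Rplus (INR (168 * D)) (IZR 2)), 27 => n n27.
  have n_gt0 : 0 < n by apply: leq_trans n27.
  have good_n := svalP (ex_g n) n_gt0.
  have [R [e [_ mults size_n [le_R le_e]]]] := good_n.
  have [k cost_k le_k] := costP n n_gt0 good_n R mults size_n.
  exists k => //; apply: Rle_trans (cost_bound r_gt0 n27 le_k le_R le_e) _.
  by right.
exists (fun n => sval (ex_g n)); split.
- by move=> n n_gt0; have [R [e []]] := svalP (ex_g n) n_gt0.
- apply: expO_cost => n _ _ R [k ck le_k] _; exists k => //; apply: leq_trans le_k _; lia.
- by apply: expO_cost => n _ _ R _.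
Qed.

(** The circuit bounds of (iii) stand beside those of (i) and (ii), as they hold for the same
    [g]. *)
Theorem theorem5 :
  (forall p1 p2 : nat, prime p1 -> prime p2 -> p1 <> p2 ->
    exists g : forall n : nat, {mpoly 'Z_(p1 * p2)[n + n]},
      [/\ forall n : nat, 0 < n ->
            degree2_one_a_strong_repr (dot_product 'Z_(p1 * p2) n) (g n),
          expO rate_two (fun n k => computable_with_mults (g n) k) &
          expO rate_two (fun n k => computable_with_size (g n) k)])
  /\
  (forall m : nat, 1 < m ->
    exists g : forall n : nat, {mpoly 'Z_m[n + n]},
      [/\ forall n : nat, 0 < n ->
            degree2_one_a_strong_repr (dot_product 'Z_m n) (g n),
          expO (rate (size (primes m)))
            (fun n k => computable_with_mults (g n) k) &
          expO (rate (size (primes m)))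
            (fun n k => computable_with_size (g n) k)]).
Proof.
split=> [p1 p2 p1_pr p2_pr neq|m m_gt1]; last exact: dot_product_expO.
have size2 : size (primes (p1 * p2)) = 2.
  have [p1_gt0 p2_gt0] := (prime_gt0 p1_pr, prime_gt0 p2_pr).
  have eqi : primes (p1 * p2) =i [:: p1; p2].
    by move=> q; rewrite primesM // !primes_prime // !inE.
  rewrite (perm_size (uniq_perm (primes_uniq _) _ eqi)) //= inE andbT.
  exact/eqP.
have [|g [g_repr g_mults g_size]] := @dot_product_expO (p1 * p2).
  by rewrite (leq_trans (prime_gt1 p1_pr)) // leq_pmulr // prime_gt0.
rewrite size2 in g_mults g_size.
(* The two rates agree from n = 27 on, so only the threshold is raised. *)
have to_rate_two cost : expO (rate 2) cost -> expO rate_two cost.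
  move=> [C [n0 bound]]; exists C, (maxn n0 27) => n.
  rewrite geq_max => /andP[/bound[k costk le_k] n27].
  by exists k; rewrite // -rate_twoE.
by exists g; split=> //; apply: to_rate_two.
Qed.
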